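(* Let $\mathcal{S} \subset \mathbb{R}^p$, let $\mathbf{x}^\ast \in \mathcal{S}$, and let $\mathcal{C} \subseteq \mathbb{R}^p$ be a closed convex set such that $\mathcal{S} \subseteq \mathcal{C}$. Let $\sigma > 0$, $n \geq 1$, and let $\mathbf{y}_1,\dots,\mathbf{y}_n$ be independent observations of $\mathbf{y} = \mathbf{x}^\ast + \sigma \mathbf{z}$ with $\mathbf{z} \sim \mathcal{N}(0, I_{p\times p})$. Let $\bar{\mathbf{y}} = \frac{1}{n}\sum_{i=1}^n \mathbf{y}_i$ and let $\hat{\mathbf{x}}_n(\mathcal{C}) = \arg\min_{\mathbf{x} \in \mathcal{C}} \frac12 \|\bar{\mathbf{y}} - \mathbf{x}\|_{\ell_2}^2$. Then $$\mathbb{E}\left[\|\mathbf{x}^\ast - \hat{\mathbf{x}}_n(\mathcal{C})\|_{\ell_2}^2\right] \leq \frac{\sigma^2}{n}\, g\big(T_{\mathcal{C}}(\mathbf{x}^\ast) \cap B^p_{\ell_2}\big).$$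
   Context: $B^p_{\ell_2}$ is the closed unit Euclidean ball in $\mathbb{R}^p$. For a closed convex set $\mathcal{C} \subseteq \mathbb{R}^p$ and $\mathbf{a} \in \mathcal{C}$, the tangent cone at $\mathbf{a}$ with respect to $\mathcal{C}$ is $T_{\mathcal{C}}(\mathbf{a}) = \mathrm{cone}\{\mathbf{b} - \mathbf{a} : \mathbf{b} \in \mathcal{C}\}$, where $\mathrm{cone}(\cdot)$ denotes the conic hull (the set of all nonnegative linear combinations of elements of the set). The Gaussian squared-complexity of a set $\mathcal{D} \subseteq \mathbb{R}^p$ is $g(\mathcal{D}) = \mathbb{E}\big[\big(\sup_{\mathbf{a} \in \mathcal{D}} \langle \mathbf{a}, \mathbf{g}\rangle\big)^2\big]$, where the expectation is over $\mathbf{g} \sim \mathcal{N}(0, I_{p\times p})$. *)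

(* Defs.v *)
From HB Require Import structures.
From mathcomp Require Import all_boot all_order all_algebra.
From mathcomp Require Import all_classical all_reals all_analysis.
Set Implicit Arguments.
Unset Strict Implicit.
Unset Printing Implicit Defensive.
Import Order.TTheory GRing.Theory Num.Theory.
Import numFieldNormedType.Exports.

Local Open Scope classical_set_scope.
Local Open Scope ring_scope.

(* The library norm on matrices is the sup norm, so the Euclidean structure is
   defined here. The two norms induce the same topology, hence the library's
   [closed] is the usual notion. *)
Definition dotr (R : realType) (p : nat) (u v : 'rV[R]_p) : R :=
  \sum_(j < p) u 0 j * v 0 j.

Definition l2norm (R : realType) (p : nat) (u : 'rV[R]_p) : R :=
  Num.sqrt (dotr u u).

Definition l2ball (R : realType) (p : nat) : set 'rV[R]_p :=
  [set u | l2norm u <= 1].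
Arguments l2ball : clear implicits.

Definition conic_hull (R : realType) (p : nat) (A : set 'rV[R]_p) :
    set 'rV[R]_p :=
  [set v | exists (k : nat) (c : 'I_k -> R) (a : 'I_k -> 'rV[R]_p),
    (forall i, 0 <= c i /\ A (a i)) /\ v = \sum_(i < k) c i *: a i].

Definition tangent_cone (R : realType) (p : nat) (C : set 'rV[R]_p)
    (a : 'rV[R]_p) : set 'rV[R]_p :=
  conic_hull [set b - a | b in C].

Definition argmin (R : realType) (T : Type) (A : set T) (f : T -> R) : set T :=
  [set x | A x /\ forall x', A x' -> f x <= f x'].

(* [get] selects an element of the set of minimizers, which is a singleton when
   [C] is nonempty, closed and convex. *)
Definition xhat (R : realType) (p : nat) (C : set 'rV[R]_p) (y : 'rV[R]_p) :
    'rV[R]_p :=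
  get (argmin C (fun x => 2^-1 * l2norm (y - x) ^+ 2)).

(* Row vectors carry the sigma-algebra generated by the coordinates, as the
   library does for tuples; over R it is the Borel sigma-algebra. *)
Definition measure_rV_display : measure_display -> measure_display.
Proof. exact. Qed.

Section measurable_rV.
Context {d : measure_display} {T : measurableType d}.
Variable n : nat.

Let coords : 'I_n -> 'rV[T]_n -> T := fun i v => v ord0 i.

Let rV_set0 : g_sigma_preimage coords set0.
Proof. exact: sigma_algebra0. Qed.

Let rV_setC A : g_sigma_preimage coords A -> g_sigma_preimage coords (~` A).
Proof. exact: sigma_algebraC. Qed.

Let rV_bigcup (F : (set 'rV[T]_n)^nat) :
  (forall i, g_sigma_preimage coords (F i)) ->
  g_sigma_preimage coords (\bigcup_i (F i)).
Proof. exact: sigma_algebra_bigcup. Qed.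

HB.instance Definition _ := @isMeasurable.Build (measure_rV_display d)
  'rV[T]_n (g_sigma_preimage coords) rV_set0 rV_setC rV_bigcup.

End measurable_rV.

Lemma measurable_rV_coord (R : realType) (n : nat) (i : 'I_n) :
  measurable_fun [set: 'rV[R]_n] (fun v : 'rV[R]_n => v ord0 i).
Proof.
move=> _ Y mY; rewrite setTI; apply: sub_sigma_algebra => /=.
rewrite -bigcup_seq/=; exists i => /=; first by rewrite mem_index_enum.
by exists Y => //; rewrite setTI.
Qed.

Lemma measurable_fun_rVP (d : measure_display) (T : measurableType d)
    (R : realType) (n : nat) (f : T -> 'rV[R]_n) :
  measurable_fun [set: T] f <->
  forall i, measurable_fun [set: T] (fun x => f x ord0 i).
Proof.
split=> [mf i|mf].
  exact: (measurableT_comp (@measurable_rV_coord R n i) mf).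
pose coords (i : 'I_n) (v : 'rV[R]_n) := v ord0 i.
suff sub : @g_sigma_preimage _ R T n (fun i => coords i \o f) `<=` measurable.
  move=> _ A mA; rewrite setTI; apply: sub.
  by rewrite (g_sigma_preimage_comp coords f); exists A => //; rewrite setTI.
apply: smallest_sub; first exact: sigma_algebra_measurable.
rewrite -bigcup_seq; apply: bigcup_sub => i _.
by move=> A [B mB <-]; exact: mf.
Qed.

Definition rV_cons (R : realType) (p : nat) (u : measurableTypeR R * 'rV[R]_p) :
    'rV[R]_p.+1 :=
  row_mx (u.1 : R)%:M u.2.

Lemma rV_cons0 (R : realType) (p : nat) (u : measurableTypeR R * 'rV[R]_p) :
  rV_cons u 0 ord0 = u.1.
Proof.
have -> : (ord0 : 'I_p.+1) = @lshift 1 p ord0 by exact/val_inj.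
by rewrite /rV_cons (@row_mxEl _ _ 1 p) mxE eqxx.
Qed.

Lemma rV_consS (R : realType) (p : nat) (u : measurableTypeR R * 'rV[R]_p) (j : 'I_p) :
  rV_cons u 0 (lift ord0 j) = u.2 0 j.
Proof.
have -> : lift ord0 j = @rshift 1 p j by exact/val_inj.
by rewrite /rV_cons (@row_mxEr _ _ 1 p).
Qed.

Lemma measurable_rV_cons (R : realType) (p : nat) :
  measurable_fun [set: measurableTypeR R * 'rV[R]_p]
    (@rV_cons R p).
Proof.
apply/measurable_fun_rVP => i; case: (unliftP ord0 i) => [j ->|->].
  under eq_fun do rewrite rV_consS.
  exact: (measurableT_comp (@measurable_rV_coord R p j) measurable_snd).
under eq_fun do rewrite rV_cons0.
exact: (@measurable_fst _ _ (measurableTypeR R) 'rV[R]_p).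
Qed.

(* [normal_prob] is a measure on [measurableTypeR R], which has the measurable
   sets of [R] but not its display. *)
HB.instance Definition _ (R : realType) (p : nat) :=
  isMeasurableFun.Build _ _ _ _ (@rV_cons R p) (@measurable_rV_cons R p).

Section product_probability.
Local Open Scope ereal_scope.
Context (d1 d2 : measure_display) (T1 : measurableType d1)
  (T2 : measurableType d2) (R : realType).
Variables (P1 : probability T1 R) (P2 : probability T2 R).

Definition product_probability : set (T1 * T2) -> \bar R := P1 \x P2.

HB.instance Definition _ := Measure.on product_probability.

Let product_probability_setT : product_probability setT = 1.
Proof.
rewrite /product_probability -setXTT product_measure1E//.
by rewrite -[RHS]mule1; congr (_ * _); exact: probability_setT.
Qed.

HB.instance Definition _ := @Measure_isProbability.Build _ _ R
  product_probability product_probability_setT.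

End product_probability.

(* N(0, I_p): the product of [p] copies of N(0, 1), carried by 'rV[R]_p. *)
Fixpoint std_gaussian (R : realType) (p : nat) : probability 'rV[R]_p R :=
  match p with
  | 0 => \d_ (0 : 'rV[R]_0)
  | p'.+1 => distribution
      (product_probability (normal_prob (0 : R) 1) (std_gaussian R p'))
      (@rV_cons R p')
  end.

Lemma std_gaussian_box (R : realType) (p : nat) (B : 'I_p -> set R) :
  (forall j, measurable (B j)) ->
  std_gaussian R p [set v : 'rV[R]_p | forall j, B j (v 0 j)] =
  (\prod_(j < p) normal_prob (0 : R) 1 (B j))%E.
Proof.
elim: p B => [|p IHp] B mB.
  rewrite big_ord0 /= diracE (_ : [set _ | _] = setT) ?in_setT//.
  by apply/seteqP; split=> // v _ [].
rewrite big_ord_recl -IHp// -product_measure1E; last 2 first.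
- exact: (mB ord0).
- rewrite (_ : [set _ | _] = \bigcap_(j in [set: 'I_p])
      ((fun v : 'rV[R]_p => v ord0 j) @^-1` B (lift ord0 j))).
    apply: fin_bigcap_measurable => // j _.
    by rewrite -[X in measurable X]setTI; exact: measurable_rV_coord.
  by apply/seteqP; split=> v /= Bv j => [_|]; exact: Bv.
rewrite /= /distribution /pushforward /product_probability; congr (_ _).
apply/seteqP; split=> u /= => [Bu|[Bu1 Bu2] j].
  split=> [|j]; first by have := Bu ord0; rewrite rV_cons0.
  by have := Bu (lift ord0 j); rewrite rV_consS.
by case: (unliftP ord0 j) => [k ->|->]; rewrite ?rV_consS ?rV_cons0.
Qed.

(* The supremum is taken in the extended reals. *)
Definition gaussian_sq_complexity (R : realType) (p : nat)
    (D : set 'rV[R]_p) : \bar R :=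
  (\int[std_gaussian R p]_g
     (ereal_sup [set (dotr a g)%:E | a in D]) ^+ 2)%E.

Definition mutually_independent (d d' : measure_display)
    (T : measurableType d) (T' : measurableType d') (R : realType)
    (P : probability T R) (n : nat) (X : 'I_n -> {RV P >-> T'}) : Prop :=
  forall (J : {set 'I_n}) (B : 'I_n -> set T'),
    (forall i, measurable (B i)) ->
    P [set w | forall i, i \in J -> B i (X i w)] =
    (\prod_(i in J) P [set w | B i (X i w)])%E.

Definition sample_mean (R : realType) (p n : nat) (y : 'I_n -> 'rV[R]_p) :
    'rV[R]_p :=
  n%:R^-1 *: \sum_(i < n) y i.

(* Main.v *)
(** Write [h] for the projection of [y := ybar] on [C] and [e := y - xstar].  The
    variational inequality for [h] gives [|h - xstar|^2 <= <h - xstar, e>], and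
    [(h - xstar) / |h - xstar|] lies in the tangent cone and in the unit ball, so
    [|h - xstar|] is at most the supremum of [<a, e>] over the cone intersected
    with the ball.  This supremum is positively homogeneous in [e], and [e] has the
    law of [sigma / sqrt n *: g]; squaring and integrating yields the bound.

    The law of the sum of the centered observations is computed one observation
    at a time, from the fact that [a *: g + g'] has the law of
    [sqrt (1 + a ^+ 2) *: g] for [g], [g'] independent standard Gaussian vectors;
    by Fubini this reduces to the one-dimensional case, where it is the completion
    of the square in the product of two normal densities. *)
Require Import Defs.
From HB Require Import structures.
From mathcomp Require Import all_boot all_order all_algebra.
From mathcomp Require Import all_classical all_reals all_analysis.
From mathcomp Require Import measurable_realfun ring lra.
Set Implicit Arguments.
Unset Strict Implicit.
Unset Printing Implicit Defensive.
Import Order.TTheory GRing.Theory Num.Theory.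
Import numFieldNormedType.Exports.

Local Open Scope classical_set_scope.
Local Open Scope ring_scope.

Lemma measurable_affine (R : realType) (m s : R) :
  measurable_fun [set: measurableTypeR R]
    (fun y : measurableTypeR R => (m + s * y) : measurableTypeR R).
Proof.
apply: (@measurable_funD _ (measurableTypeR R) R _ (cst m) (fun y => s * y)) => //.
exact: (@measurable_funM _ (measurableTypeR R) R _ (cst s) id).
Qed.

Lemma lebesgue_measure_affine (R : realType) (m s : R)
    (A : set (measurableTypeR R)) : 0 < s -> measurable A ->
  (s%:E * lebesgue_measure [set y : measurableTypeR R | A (m + s * y)%R] =
   lebesgue_measure A)%E.
Proof.
move=> s0 mA.
pose nu : {measure set (measurableTypeR R) -> \bar R} :=
  mscale (NngNum (ltW s0)) (pushforward lebesgue_measure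
    (fun y : measurableTypeR R => (m + s * y) : measurableTypeR R)).
apply/esym; rewrite (_ : (s%:E * _)%E = nu (measurable_affine m s) A)//.
apply: lebesgue_measure_unique => //= _ [[a b]] _ <-.
rewrite /nu/= /mscale/= /pushforward.
rewrite (_ : _ @^-1` _ = `]((a - m) / s), ((b - m) / s)]%classic).
  rewrite !lebesgue_measure_itv/= !lte_fin ltr_pM2r ?invr_gt0// ltrD2r.
  case: ifPn => _; last by rewrite mule0.
  by rewrite -!EFinB -EFinM -mulrBl mulrC divfK ?gt_eqF// opprB addrA subrK.
apply/seteqP; split=> y /=;
  by rewrite !in_itv/= ltr_pdivrMr// ler_pdivlMr// ltrBlDl lerBrDl [s * y]mulrC.
Qed.

Lemma integral_lebesgue_affine (R : realType) (m s : R) (f : R -> \bar R) :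
  0 < s -> measurable_fun [set: R] f -> (forall x, 0 <= f x)%E ->
  (s%:E * \int[lebesgue_measure]_y f (m + s * y)%R =
   \int[lebesgue_measure]_y f y)%E.
Proof.
move=> s0 mf f0.
transitivity (s%:E * \int[pushforward lebesgue_measure (fun y : measurableTypeR R =>
    (m + s * y)%R : measurableTypeR R)]_y f y)%E.
  by rewrite (ge0_integral_pushforward (measurable_affine m s)).
rewrite -[in LHS](@ge0_integral_mscale _ _ _ _ _ _ (NngNum (ltW s0)))//.
  exact: measurable_affine.
by move=> maffine; apply: eq_measure_integral => A mA _; exact: lebesgue_measure_affine.
Qed.

Lemma integral_normal_prob (R : realType) (m s : R) (f : R -> \bar R) :
  (normal_prob m s).-integrable [set: R] f ->
  (\int[normal_prob m s]_x f x =
   \int[lebesgue_measure]_x (f x * (normal_pdf m s x)%:E))%E.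
Proof.
move=> intf.
have mpdf := measurable_normal_pdf m s.
rewrite -(Radon_Nikodym_change_of_variables (normal_prob_dominates m s))//=.
apply: ae_eq_integral => //.
- apply: emeasurable_funM => //; first exact: (measurable_int _ intf).
  apply: (measurable_int lebesgue_measure).
  by apply: Radon_Nikodym_integrable; exact: normal_prob_dominates.
- apply: emeasurable_funM; first exact: (measurable_int _ intf).
  exact/measurable_EFinP.
- apply: ae_eqe_mul2l => /=.
  apply: integral_ae_eq => //=.
  + by apply: Radon_Nikodym_integrable; exact: normal_prob_dominates.
  + exact/measurable_EFinP.
  + move=> E _ mE; rewrite -Radon_Nikodym_integral//.
    exact: normal_prob_dominates.
Qed.

Lemma normal_prob_affine (R : realType) (m s : R) (A : set (measurableTypeR R)) :
  0 < s -> measurable A ->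
  normal_prob 0 1 [set y : measurableTypeR R | A (m + s * y)] = normal_prob m s A.
Proof.
move=> s0 mA; rewrite /normal_prob [LHS]integral_mkcond [RHS]integral_mkcond.
have pdf0 : (forall x, 0 <= ((EFin \o normal_pdf m s) \_ A) x)%E.
  by move=> x; apply: erestrict_ge0 => y _; rewrite lee_fin normal_pdf_ge0.
have mpdf : measurable_fun [set: R] ((EFin \o normal_pdf m s) \_ A).
  apply: (measurable_restrictT _ _).1 => //.
  by apply: measurable_funTS; apply/measurable_EFinP; exact: measurable_normal_pdf.
rewrite -[RHS](@integral_lebesgue_affine _ m s)// -ge0_integralZl//; last 2 first.
- exact: (measurableT_comp mpdf (measurable_affine m s)).
- by rewrite lee_fin ltW.
apply: eq_integral => y _; rewrite !patchE.
rewrite (_ : (y \in _) = (m + s * y \in A)); last by apply/idP/idP; rewrite !inE.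
case: ifP => [_|]; last by rewrite mule0.
rewrite /= -EFinM; congr EFin; rewrite !normal_pdfE ?oner_eq0 ?gt_eqF//.
rewrite mulrA /normal_peak /normal_fun subr0 addrAC subrr add0r; congr (_ * expR _).
  rewrite expr1n mul1r -mulrnAr [Num.sqrt (s ^+ 2 * _)]sqrtrM ?sqr_ge0//.
  rewrite sqrtr_sqr gtr0_norm//.
  by rewrite invfM mulrA divff ?mul1r// gt_eqF.
by field; rewrite gt_eqF.
Qed.

Lemma normal_prob_shift (R : realType) (m : R) (A : set (measurableTypeR R)) :
  measurable A ->
  normal_prob 0 1 [set y : measurableTypeR R | A (m + y)] = normal_prob m 1 A.
Proof.
move=> mA; rewrite -(normal_prob_affine m ltr01 mA).
by under [in RHS]eq_set do rewrite mul1r.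
Qed.

Lemma normal_prob_scale (R : realType) (s : R) (A : set (measurableTypeR R)) :
  0 < s -> measurable A ->
  normal_prob 0 1 [set z : measurableTypeR R | A (s * z)] = normal_prob 0 s A.
Proof.
move=> s0 mA; rewrite -(normal_prob_affine 0 s0 mA).
by under [in RHS]eq_set do rewrite add0r.
Qed.

(* Completing the square: the conditional law of [x] given [a * x + y = t] is
   normal with mean [a * t / s ^+ 2] and standard deviation [s^-1]. *)
Lemma normal_pdf_mul (R : realType) (a s x t : R) : 0 < s -> s ^+ 2 = 1 + a ^+ 2 ->
  normal_pdf (a * x) 1 t * normal_pdf 0 1 x =
  normal_pdf 0 s t * normal_pdf (a * t / s ^+ 2) s^-1 x.
Proof.
move=> s0 s2; have sN0 : s != 0 by rewrite gt_eqF.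
rewrite !normal_pdfE ?invr_eq0 ?oner_eq0// mulrACA [RHS]mulrACA; congr (_ * _).
  rewrite /normal_peak -!invfM -!sqrtrM ?mulrn_wge0 ?mulr_ge0 ?sqr_ge0 ?pi_ge0
    ?(ltW s0)//.
  congr (Num.sqrt _)^-1; rewrite exprVn; move: (pi : R) => c.
  by field.
rewrite /normal_fun -!expRD; congr expR.
have s2N0 : s ^+ 2 != 0 by rewrite expf_neq0.
have a2N0 : 1 + a ^+ 2 != 0 by rewrite -s2.
rewrite exprVn s2 !subr0 !expr1n -[(1 + a ^+ 2)^-1 *+ 2]mulr_natr invfM invrK.
rewrite -[(1 + a ^+ 2) *+ 2]mulr_natr.
by field.
Qed.

Lemma normal_prob_convolution (R : realType) (a s : R)
    (A : set (measurableTypeR R)) :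
  0 < s -> s ^+ 2 = 1 + a ^+ 2 -> measurable A ->
  (\int[normal_prob 0 1]_x
     normal_prob 0 1 [set y : measurableTypeR R | A (a * x + y)%R] =
   normal_prob 0 1 [set z : measurableTypeR R | A (s * z)%R])%E.
Proof.
move=> s0 s2 mA.
pose TR := measurableTypeR R.
have mlin : measurable_fun [set: TR * TR] (fun u : TR * TR => (a * u.1 + u.2) : TR).
  apply: (@measurable_funD _ (TR * TR)%type R _ (fun u => a * u.1) snd) => //.
  by apply: (@measurable_funM _ (TR * TR)%type R _ (cst a) fst).
have msec : measurable_fun [set: TR]
    (fun x => normal_prob 0 1 [set y : TR | A (a * x + y)%R]).
  have mE : measurable [set u : TR * TR | A (a * u.1 + u.2)].
    by rewrite -[X in measurable X]setTI; exact: mlin.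
  have := measurable_fun_xsection (normal_prob 0 1) mE.
  apply: eq_measurable_fun => x _ /=; congr (normal_prob _ _ _).
  by apply/seteqP; split=> y /=; rewrite /xsection/= inE.
rewrite integral_normal_prob; last first.
  apply/integrableP; split => //.
  apply: (@le_lt_trans _ _ (\int[normal_prob (0 : R) 1]_x (cst 1%E x))%E).
    apply: ge0_le_integral => //=; first exact: measurableT_comp.
    by move=> x _; rewrite gee0_abs// probability_le1// -[X in measurable X]setTI;
      apply: (measurableT_comp mlin (pair1_measurable x)).
  by rewrite integral_cst//= probability_setT mule1 ltry.
pose f (u : TR * TR) : R :=
  normal_pdf (a * u.1) 1 u.2 * \1_A u.2 * normal_pdf 0 1 u.1.
have f0 u : 0 <= f u by rewrite !mulr_ge0// normal_pdf_ge0.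
have mf : measurable_fun [set: TR * TR] (EFin \o f).
  apply/measurable_EFinP; apply: measurable_funM; last first.
    by apply: (measurableT_comp (measurable_normal_pdf 0 1)); exact: measurable_fst.
  apply: measurable_funM; last first.
    have m1A : measurable_fun [set: TR] (\1_A : TR -> R) by exact: measurable_indic.
    exact: (measurableT_comp m1A measurable_snd).
  rewrite (_ : (fun _ => _) = (normal_pdf 0 1 : TR -> R) \o
      (fun u : TR * TR => (- a * u.1 + u.2) : TR)).
    apply: measurableT_comp; first exact: measurable_normal_pdf.
    apply: (@measurable_funD _ (TR * TR)%type R _ (fun u => - a * u.1) snd) => //.
    by apply: (@measurable_funM _ (TR * TR)%type R _ (cst (- a)) fst).
  apply/funext => u /=; rewrite !normal_pdfE ?oner_eq0// /normal_fun.
  by rewrite (_ : - a * u.1 + u.2 - 0 = u.2 - a * u.1)// subr0 mulNr addrC.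
transitivity (\int[lebesgue_measure]_x \int[lebesgue_measure]_t (f (x, t))%:E)%E.
  apply: eq_integral => x _.
  transitivity (normal_prob (a * x) 1 A * (normal_pdf 0 1 x)%:E)%E.
    by rewrite normal_prob_shift.
  rewrite /normal_prob [X in (X * _)%E]integral_mkcond -ge0_integralZr//.
  - apply: eq_integral => t _; rewrite /f patchE indicE/=.
    by case: (t \in A); rewrite ?mulr1// mulr0 mul0r mul0e.
  - apply: (measurable_restrictT _ _).1 => //.
    by apply: measurable_funTS; apply/measurable_EFinP; exact: measurable_normal_pdf.
  - by move=> y _; apply: erestrict_ge0 => z _; rewrite lee_fin normal_pdf_ge0.
  - by rewrite lee_fin normal_pdf_ge0.
rewrite (@fubini_tonelli _ _ _ _ _ _ _ (EFin \o f))//=.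
transitivity (normal_prob 0 s A).
  rewrite /normal_prob [RHS]integral_mkcond; apply: eq_integral => t _.
  transitivity (\int[lebesgue_measure]_x ((normal_pdf 0 s t * \1_A t)%:E *
      (normal_pdf (a * t / s ^+ 2) s^-1 x)%:E))%E.
    apply: eq_integral => x _; rewrite /f/= -EFinM; congr EFin.
    by rewrite mulrAC (normal_pdf_mul _ _ s0 s2) mulrAC.
  rewrite ge0_integralZl//.
  - rewrite integral_normal_pdf mule1 patchE indicE.
    by case: (t \in A); rewrite ?mulr1// mulr0.
  - by apply/measurable_EFinP; exact: measurable_normal_pdf.
  - by move=> x _; rewrite lee_fin normal_pdf_ge0.
  - by rewrite lee_fin mulr_ge0// normal_pdf_ge0.
by rewrite normal_prob_scale.
Qed.

Lemma integral_normal_convolution (R : realType) (a s : R)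
    (f : measurableTypeR R -> \bar R) :
  0 < s -> s ^+ 2 = 1 + a ^+ 2 ->
  measurable_fun [set: measurableTypeR R] f -> (forall x, 0 <= f x)%E ->
  (\int[normal_prob 0 1]_x \int[normal_prob 0 1]_y f (a * x + y)%R =
   \int[normal_prob 0 1]_z f (s * z)%R)%E.
Proof.
move=> s0 s2 mf f0.
pose TR := measurableTypeR R.
pose lin (u : TR * TR) : TR := a * u.1 + u.2.
have mlin : measurable_fun [set: TR * TR] lin.
  apply: (@measurable_funD _ (TR * TR)%type R _ (fun u => a * u.1) snd) => //.
  by apply: (@measurable_funM _ (TR * TR)%type R _ (cst a) fst).
have mscale : measurable_fun [set: TR] (fun z : TR => (s * z) : TR).
  by apply: (@measurable_funM _ TR R _ (cst s) id).
have mflin : measurable_fun [set: TR * TR] (f \o lin) by exact: measurableT_comp.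
rewrite -(fubini_tonelli1 (f \o lin))//=.
transitivity (\int[pushforward (normal_prob 0 1 \x normal_prob 0 1)%E lin]_z f z)%E.
  by rewrite ge0_integral_pushforward.
transitivity (\int[pushforward (normal_prob 0 1) (fun z : TR => (s * z)%R : TR)]_z f z)%E;
  last by rewrite ge0_integral_pushforward.
apply: eq_measure_integral => A mA _.
apply: (etrans _ (normal_prob_convolution s0 s2 mA)); apply: eq_integral => x _.
rewrite /= (_ : xsection _ x = [set y : TR | A (a * x + y)%R])//.
by apply/seteqP; split=> y /=; rewrite /xsection/= inE.
Qed.

Lemma integral_std_gaussianS (R : realType) (p : nat) (F : 'rV[R]_p.+1 -> \bar R) :
  measurable_fun [set: 'rV[R]_p.+1] F -> (forall v, 0 <= F v)%E ->
  (\int[std_gaussian R p.+1]_v F v =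
   \int[normal_prob 0 1]_x \int[std_gaussian R p]_u F (rV_cons (x, u)))%E.
Proof.
move=> mF F0; rewrite /= ge0_integral_distribution//.
apply: (fubini_tonelli1 (F \o @rV_cons R p)) => [|u]; last exact: F0.
exact: (measurableT_comp mF (@measurable_rV_cons R p)).
Qed.

Lemma measurable_rV_comb (R : realType) (p : nat) (a : R) :
  measurable_fun [set: 'rV[R]_p * 'rV[R]_p]
    (fun u : 'rV[R]_p * 'rV[R]_p => a *: u.1 + u.2).
Proof.
apply/measurable_fun_rVP => i; under eq_fun do rewrite !mxE.
apply: measurable_funD;
  last exact: (measurableT_comp (measurable_rV_coord i) measurable_snd).
apply: measurable_funM; first exact: measurable_cst.
exact: (measurableT_comp (measurable_rV_coord i) measurable_fst).
Qed.

Lemma rV_cons_comb (R : realType) (p : nat) (a x y : R) (u v : 'rV[R]_p) :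
  a *: rV_cons (x, u) + rV_cons (y, v) = rV_cons (a * x + y, a *: u + v).
Proof.
apply/rowP => i; rewrite [LHS]mxE [X in X + _]mxE.
case: (unliftP ord0 i) => [j ->|->]; first by rewrite !rV_consS !mxE.
by rewrite !rV_cons0.
Qed.

Lemma rV_cons_scale (R : realType) (p : nat) (s x : R) (u : 'rV[R]_p) :
  s *: rV_cons (x, u) = rV_cons (s * x, s *: u).
Proof.
apply/rowP => i; rewrite [LHS]mxE.
case: (unliftP ord0 i) => [j ->|->]; first by rewrite !rV_consS !mxE.
by rewrite !rV_cons0.
Qed.

Lemma measurable_rV_scale (R : realType) (p : nat) (s : R) :
  measurable_fun [set: 'rV[R]_p] (fun u : 'rV[R]_p => s *: u).
Proof.
apply/measurable_fun_rVP => i; under eq_fun do rewrite !mxE.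
by apply: measurable_funM => //; exact: measurable_rV_coord.
Qed.

Lemma integral_std_gaussian_convolution (R : realType) (p : nat) (a s : R)
    (F : 'rV[R]_p -> \bar R) :
  0 < s -> s ^+ 2 = 1 + a ^+ 2 ->
  measurable_fun [set: 'rV[R]_p] F -> (forall v, 0 <= F v)%E ->
  (\int[std_gaussian R p]_u \int[std_gaussian R p]_v F (a *: u + v)%R =
   \int[std_gaussian R p]_w F (s *: w)%R)%E.
Proof.
move=> s0 s2; elim: p F => [|p IHp] F mF F0.
  have Fc v : F v = F 0 by rewrite [v]thinmx0.
  under eq_integral => u _ do (under eq_integral => v _ do rewrite Fc).
  under [RHS]eq_integral => w _ do rewrite Fc.
  have intc c : (\int[std_gaussian R 0]_u c = c)%E.
    by rewrite integral_cst// [X in (_ * X)%E]probability_setT mule1.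
  by rewrite !intc.
pose TR := measurableTypeR R.
have mFcons : measurable_fun [set: TR * 'rV[R]_p] (F \o @rV_cons R p).
  exact: (measurableT_comp mF (@measurable_rV_cons R p)).
pose H (t : TR) := (\int[std_gaussian R p]_w F (rV_cons (t, s *: w)))%E.
have H0 t : (0 <= H t)%E by exact: integral_ge0.
have mH : measurable_fun [set: TR] H.
  apply: (measurable_fun_fubini_tonelli_F
    (fun u : TR * 'rV[R]_p => F (rV_cons (u.1, s *: u.2)))) => //.
  apply: (measurableT_comp mFcons); apply: measurable_fun_pair => //.
  exact: (measurableT_comp (measurable_rV_scale s) measurable_snd).
transitivity (\int[normal_prob 0 1]_x \int[normal_prob 0 1]_y H (a * x + y)%R)%E;
  last first.
  rewrite (integral_normal_convolution s0 s2)// integral_std_gaussianS//.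
  - by apply: eq_integral => x _; apply: eq_integral => u _; rewrite rV_cons_scale.
  - exact: (measurableT_comp mF (measurable_rV_scale s)).
rewrite integral_std_gaussianS; last 2 first.
- apply: (measurable_fun_fubini_tonelli_F
    (fun u : 'rV[R]_p.+1 * 'rV[R]_p.+1 => F (a *: u.1 + u.2))) => //.
  exact: (measurableT_comp mF (measurable_rV_comb a)).
- by move=> v; exact: integral_ge0.
apply: eq_integral => x _.
transitivity (\int[std_gaussian R p]_u \int[normal_prob 0 1]_y
    \int[std_gaussian R p]_v F (rV_cons ((a * x + y)%R, (a *: u + v)%R)))%E.
  apply: eq_integral => u _; rewrite integral_std_gaussianS//.
  - by apply: eq_integral => y _; apply: eq_integral => v _; rewrite rV_cons_comb.
  - exact: (measurableT_comp (measurableT_comp mF (measurable_rV_comb a))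
      (pair1_measurable (rV_cons (x, u)))).
rewrite (fubini_tonelli (fun z : 'rV[R]_p * TR => \int[std_gaussian R p]_v
    F (rV_cons ((a * x + z.2)%R, (a *: z.1 + v)%R)))%E)//; last 2 first.
- apply: (measurable_fun_fubini_tonelli_F
    (fun z : ('rV[R]_p * TR) * 'rV[R]_p =>
      F (rV_cons ((a * x + z.1.2)%R, (a *: z.1.1 + z.2)%R)))) => //.
  apply: (measurableT_comp mFcons); apply: measurable_fun_pair.
    apply: measurable_funD => //.
    exact: (measurableT_comp measurable_snd measurable_fst).
  apply: (measurableT_comp (measurable_rV_comb a)
    (g := fun z : ('rV[R]_p * TR) * 'rV[R]_p => (z.1.1, z.2))).
  apply: measurable_fun_pair => //.
  exact: (measurableT_comp measurable_fst measurable_fst).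
- by move=> z; exact: integral_ge0.
apply: eq_integral => y _ /=.
apply: (IHp (fun v => F (rV_cons (a * x + y, v)))) => //.
exact: (measurableT_comp mFcons (pair1_measurable (a * x + y))).
Qed.

Lemma independent_tail (R : realType) (d d' : measure_display)
    (Omega : measurableType d) (T : measurableType d') (P : probability Omega R)
    (n : nat) (y : 'I_n -> {RV P >-> T}) (k : 'I_n) (A : set T) (B : 'I_n -> set T) :
  mutually_independent y -> measurable A -> (forall i, measurable (B i)) ->
  (P [set w | A (y k w) /\ forall i : 'I_n, (k < i)%N -> B i (y i w)] =
   P [set w | A (y k w)] *
   P [set w | forall i : 'I_n, (k < i)%N -> B i (y i w)])%E.
Proof.
move=> hy mA mB.
pose J := [set i : 'I_n | (k < i)%N]%SET.
have kJ : k \notin J by rewrite inE ltnn.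
pose C i := if i == k then A else B i.
have mC i : measurable (C i) by rewrite /C; case: ifP.
have tailE : [set w | forall i : 'I_n, (k < i)%N -> B i (y i w)] =
    [set w | forall i, i \in J -> C i (y i w)].
  apply/seteqP; split=> w /= H i; have := H i; rewrite inE /C.
    by case: eqP => [->|//]; rewrite ltnn.
  by case: eqP => [->|//]; rewrite ltnn.
have -> : [set w | A (y k w) /\ forall i : 'I_n, (k < i)%N -> B i (y i w)] =
    [set w | forall i, i \in (k |: J)%SET -> C i (y i w)].
  have -> : [set w | A (y k w) /\ forall i : 'I_n, (k < i)%N -> B i (y i w)] =
    [set w | A (y k w)] `&` [set w | forall i : 'I_n, (k < i)%N -> B i (y i w)] by [].
  rewrite tailE; apply/seteqP; split=> w /=.
    by move=> [Aw Jw] i; rewrite in_setU1 => /orP[/eqP ->|/Jw//]; rewrite /C eqxx.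
  move=> H; split=> [|i iJ]; last by apply: H; rewrite in_setU1 iJ orbT.
  by have := H k; rewrite in_setU1 eqxx /C eqxx; apply.
rewrite tailE !hy// big_setU1//=; congr (_ * _)%E.
by rewrite /C eqxx.
Qed.

Lemma measurable_centered_sum (R : realType) (p : nat) (d : measure_display)
    (Omega : measurableType d) (P : probability Omega R) (n : nat)
    (y : 'I_n -> {RV P >-> 'rV[R]_p}) (x : 'rV[R]_p) (J : pred 'I_n) :
  measurable_fun [set: Omega] (fun w => \sum_(i | J i) (y i w - x)).
Proof.
apply/measurable_fun_rVP => j; under eq_fun do rewrite summxE big_mkcond/=.
apply: measurable_sum => i; case: (J i); last exact: measurable_cst.
under eq_fun do rewrite !mxE.
apply: measurable_funB => //.
exact: (measurableT_comp (measurable_rV_coord j) (measurable_funP (y i))).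
Qed.

Section sample_sum.
Variables (R : realType) (p : nat) (x : 'rV[R]_p) (sigma : R) (n : nat).
Variables (d : measure_display) (Omega : measurableType d) (P : probability Omega R).
Variable y : 'I_n -> {RV P >-> 'rV[R]_p}.
Hypothesis indep_y : mutually_independent y.
Hypothesis law_y : forall (i : 'I_n) (A : set 'rV[R]_p), measurable A ->
  distribution P (y i) A =
  pushforward (std_gaussian R p) (fun z : 'rV[R]_p => x + sigma *: z) A.

Let sum k w := \sum_(i : 'I_n | (i < k)%N) (y i w - x).

(* The factor on the tail of the sample is what makes the induction on [k] go
   through: it records that [sum k] is independent of the later observations. In
   the step, the law of [(sum k, y k)] restricted to the tail event and the
   product of the laws of [sum k] and [y k] agree on rectangles up to a constant. *)
Lemma partial_sum_law (k : nat) (A : set 'rV[R]_p) (B : 'I_n -> set 'rV[R]_p) :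
  (k <= n)%N -> measurable A -> (forall i, measurable (B i)) ->
  (P [set w | A (sum k w) /\ forall i : 'I_n, (k <= i)%N -> B i (y i w)] =
   std_gaussian R p [set g | A ((Num.sqrt k%:R * sigma) *: g)] *
   P [set w | forall i : 'I_n, (k <= i)%N -> B i (y i w)])%E.
Proof.
elim: k A B => [|k IHk] A B kn mA mB.
  have sum0 w : sum 0 w = 0 by rewrite /sum big_pred0.
  under eq_set do rewrite sum0.
  under [in RHS]eq_set do rewrite sqrtr0 mul0r scale0r.
  have [A0|NA0] := pselect (A 0).
    rewrite (_ : [set g | A 0] = setT) ?probability_setT ?mul1e; last first.
      by apply/seteqP; split.
    by congr (P _); apply/seteqP; split=> w //= -[].
  rewrite (_ : [set g | A 0] = set0) ?measure0 ?mul0e; last first.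
    by apply/seteqP; split.
  by rewrite (_ : [set w | _] = set0) ?measure0//; apply/seteqP; split=> w //= -[].
pose k0 : 'I_n := Ordinal kn.
set D := [set w | forall i : 'I_n, (k < i)%N -> B i (y i w)].
have mD : measurable D.
  rewrite (_ : D = \bigcap_(i in [set i : 'I_n | (k < i)%N]) (y i @^-1` B i)).
    apply: fin_bigcap_measurable => // i _.
    by rewrite -[X in measurable X]setTI; exact: (measurable_funP (y i)).
  by apply/seteqP; split.
have sumS w : sum k.+1 w = sum k w + (y k0 w - x).
  rewrite /sum (bigD1 k0)//= addrC; congr (_ + _); apply: eq_bigl => i.
  by rewrite ltnS andbC -val_eqE/= ltn_neqAle.
pose e (u : 'rV[R]_p * 'rV[R]_p) := u.1 + (u.2 - x).
have me : measurable_fun [set: 'rV[R]_p * 'rV[R]_p] e.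
  apply/measurable_fun_rVP => j; under eq_fun do rewrite !mxE.
  apply: measurable_funD; last apply: measurable_funB => //.
    exact: (measurableT_comp (measurable_rV_coord j) measurable_fst).
  exact: (measurableT_comp (measurable_rV_coord j) measurable_snd).
have mEA : measurable (e @^-1` A) by rewrite -[X in measurable X]setTI; exact: me.
have mpair : measurable_fun [set: Omega] (fun w => (sum k w, y k0 w)).
  by apply: measurable_fun_pair => //; exact: measurable_centered_sum.
have mPD : measurable_fun [set: 'rV[R]_p]
    (fun g : 'rV[R]_p => (Num.sqrt k%:R * sigma) *: g).
  exact: measurable_rV_scale.
have mevent (X : set ('rV[R]_p * 'rV[R]_p)) : measurable X ->
    measurable [set w | X (sum k w, y k0 w)].
  by move=> mX; rewrite -[X in measurable X]setTI; exact: mpair.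
have -> : [set w | A (sum k.+1 w) /\ forall i : 'I_n, (k < i)%N -> B i (y i w)] =
    [set w | (e @^-1` A) (sum k w, y k0 w)] `&` D.
  by under eq_set do rewrite sumS.
have [D0|D0] := eqVneq (P D) 0.
  rewrite D0 mule0; apply/eqP; rewrite eq_le measure_ge0 andbT -D0.
  by rewrite le_measure ?inE//; apply: measurableI => //; exact: mevent.
have finD : P D \is a fin_num by exact: fin_num_measure.
have cD : fine (P D) != 0 by rewrite fine_eq0.
have c0 : 0 <= (fine (P D))^-1 by rewrite invr_ge0 fine_ge0.
pose m' : {measure set ('rV[R]_p * 'rV[R]_p) -> \bar R} :=
  mscale (NngNum c0) (pushforward (mrestr P mD) (fun w => (sum k w, y k0 w))).
pose scale : {mfun 'rV[R]_p >-> 'rV[R]_p} :=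
  HB.pack (fun g : 'rV[R]_p => (Num.sqrt k%:R * sigma) *: g)
    (isMeasurableFun.Build _ _ _ _ _ mPD).
pose m1 := distribution (std_gaussian R p) scale.
pose m2 := distribution P (y k0).
have m'E A' B' : measurable A' -> measurable B' ->
    m' mpair (A' `*` B') = (m1 A' * m2 B')%E.
  move=> mA' mB'; pose B'' i := if i == k0 then B' else B i.
  have mB'' i : measurable (B'' i) by rewrite /B''; case: ifP.
  have tailE : [set w | forall i : 'I_n, (k <= i)%N -> B'' i (y i w)] =
      [set w | B' (y k0 w) /\ forall i : 'I_n, (k < i)%N -> B i (y i w)].
    apply/seteqP; split=> w /=.
      move=> Bw; split=> [|i ki]; first by have := Bw k0 (leqnn _); rewrite /B'' eqxx.
      have := Bw i (ltnW ki); rewrite /B''; case: eqP => // ik0.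
      by move: ki; rewrite ik0 ltnn.
    move=> [B'w Bw] i; rewrite leq_eqVlt /B'' -val_eqE/= [_ == k]eq_sym.
    by case: eqP => [ki _|_ /Bw//]; rewrite (_ : i = k0)//; exact: val_inj.
  have := IHk A' B'' (ltnW kn) mA' mB''.
  have tailP : P [set w | B' (y k0 w) /\ forall i : 'I_n, (k < i)%N -> B i (y i w)] =
    (m2 B' * P D)%E := independent_tail k0 indep_y mB' mB.
  rewrite tailE tailP => IH.
  rewrite /m'/= /mscale/= /pushforward /mrestr/=.
  rewrite (_ : _ `&` D = [set w | A' (sum k w) /\
    forall i : 'I_n, (k <= i)%N -> B'' i (y i w)]); last first.
    rewrite (_ : [set w | A' (sum k w) /\ _] = [set w | A' (sum k w)] `&`
      [set w | forall i : 'I_n, (k <= i)%N -> B'' i (y i w)])// tailE.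
    by apply/seteqP; split=> w /=; tauto.
  rewrite IH muleCA [X in (_ * X)%E]muleCA.
  by rewrite -[X in (_ * (_ * (_ * X)))%E](fineK finD) -EFinM mulVf// mule1.
have convE : (m1 \x m2)%E (e @^-1` A) =
    std_gaussian R p [set g | A ((Num.sqrt k.+1%:R * sigma) *: g)].
  pose F v := (\1_A (sigma *: v) : R)%:E.
  have mF : measurable_fun [set: 'rV[R]_p] F.
    by apply/measurable_EFinP; apply: (measurableT_comp _ (measurable_rV_scale sigma));
      exact: measurable_indic.
  have F0 v : (0 <= F v)%E by rewrite lee_fin.
  have intF (f : 'rV[R]_p -> 'rV[R]_p) : measurable_fun [set: 'rV[R]_p] f ->
      (\int[std_gaussian R p]_v F (f v) =
       std_gaussian R p [set v | A (sigma *: f v)])%E.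
    move=> mf; rewrite -[X in std_gaussian R p X]setIT -integral_indic//.
      by rewrite -[X in measurable X]setTI;
        apply: (measurableT_comp (measurable_rV_scale sigma) mf).
  transitivity (\int[std_gaussian R p]_u \int[std_gaussian R p]_v
      F (Num.sqrt k%:R *: u + v)%R)%E.
    transitivity (\int[m1]_u m2 (xsection (e @^-1` A) u))%E; first by [].
    rewrite ge0_integral_distribution//; last exact: measurable_fun_xsection.
    apply: eq_integral => u _; rewrite intF; last first.
      exact: (measurableT_comp (measurable_rV_comb _) (pair1_measurable u)).
    apply: (etrans (law_y k0 (measurable_xsection _ mEA))).
    rewrite /pushforward; congr (std_gaussian R p _).
    apply/seteqP; split=> v /=; rewrite /xsection/= inE /e/= addrAC subrr add0r;
      by rewrite scalerDr scalerA [sigma * _]mulrC.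
  rewrite (@integral_std_gaussian_convolution _ _ _ (Num.sqrt k.+1%:R))//.
  - rewrite (intF (fun w => Num.sqrt k.+1%:R *: w)); last exact: measurable_rV_scale.
    by under eq_set do rewrite scalerA mulrC.
  - by rewrite !sqr_sqrtr// -natr1 addrC.
have := product_measure_unique m'E mEA.
rewrite convE => ->; rewrite /m'/= /mscale/= /pushforward /mrestr/=.
by rewrite muleAC -[X in (_ * X * _)%E](fineK finD) -EFinM mulVf// mul1e.
Qed.
End sample_sum.

Lemma open_measurable_rV (R : realType) (p : nat) (U : set 'rV[R]_p) :
  open U -> measurable U.
Proof.
move=> oU.
pose box (q : 'rV[rat]_p * 'rV[rat]_p) : set 'rV[R]_p :=
  [set v | forall j, (v 0 j : R) \in `]ratr (q.1 0 j), ratr (q.2 0 j)[].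
have mbox q : measurable (box q).
  rewrite (_ : box q = \bigcap_(j in [set: 'I_p]) ((fun v : 'rV[R]_p => v ord0 j) @^-1`
      `]ratr (q.1 0 j), ratr (q.2 0 j)[%classic)).
    apply: fin_bigcap_measurable => // j _.
    rewrite -[X in measurable X]setTI; apply: measurable_rV_coord => //.
  by apply/seteqP; split=> v /= Bv j => [_|]; have := Bv j; rewrite /= ?in_itv//=; apply.
pose F q : set 'rV[R]_p := if pselect (box q `<=` U) then box q else set0.
suff -> : U = \bigcup_q F q.
  apply: countable_bigcupT_measurable; first exact: countableP.
  by move=> q; rewrite /F; case: pselect => /= _; [exact: mbox|exact: measurable0].
apply/seteqP; split=> [v Uv|v [q _]]; last first.
  by rewrite /F; case: pselect => // bU /bU.
have /nbhs_ballP[e /= e0 eU] : nbhs v U by exact: open_nbhs_nbhs.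
have /choice[lo lo_v] : forall j, exists q : rat, v 0 j - e < ratr q < v 0 j.
  move=> j; have [|q] := @rat_in_itvoo R (v 0 j - e) (v 0 j);
    last by rewrite in_itv/= => ?; exists q.
  by rewrite ltrBlDr ltrDl.
have /choice[hi hi_v] : forall j, exists q : rat, v 0 j < ratr q < v 0 j + e.
  move=> j; have [|q] := @rat_in_itvoo R (v 0 j) (v 0 j + e);
    last by rewrite in_itv/= => ?; exists q.
  by rewrite ltrDl.
exists (\row_j lo j, \row_j hi j) => //.
rewrite /F; case: pselect => [_ j|].
  rewrite /= !mxE in_itv/=.
  by have /andP[_ ->] := lo_v j; have /andP[-> _] := hi_v j.
case=> w /= boxw; apply: eU; split=> // i j; rewrite ord1 /ball/= ltr_distlC.
have := boxw j; rewrite !mxE in_itv/= => /andP[low whi].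
have /andP[elo _] := lo_v j; have /andP[_ hie] := hi_v j.
by rewrite (lt_trans elo)//= (lt_trans whi).
Qed.

Lemma continuous_dotr (R : realType) (p : nat) (f g : 'rV[R]_p -> 'rV[R]_p) :
  continuous f -> continuous g -> continuous (fun v => dotr (f v) (g v)).
Proof.
move=> cf cg; rewrite /dotr; apply: continuous_big => [|j _].
  exact: (@pseudometric_normed_Zmodule.add_continuous R R).
have coord (h : 'rV[R]_p -> 'rV[R]_p) : continuous h -> continuous (fun v => h v 0 j : R).
  move=> ch v; apply: (@continuous_comp _ _ _ h (fun w : 'rV[R]_p => w 0 j : R)).
    exact: ch.
  exact: (@coord_continuous R 1 p 0 j).
by move=> v; apply: continuousM; exact: coord.
Qed.

Lemma measurable_sup_dotr (R : realType) (p : nat) (D : set 'rV[R]_p) :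
  measurable_fun [set: 'rV[R]_p] (fun g => ereal_sup [set (dotr a g)%:E | a in D]).
Proof.
apply: (measurability _ (ErealGenOInfty.measurableE R)) => _ [_ [c ->] <-].
rewrite setTI (_ : _ @^-1` _ = \bigcup_(a in D) [set g | c < dotr a g]).
  apply: open_measurable_rV; apply: bigcup_open => a _.
  apply: (@open_comp _ _ (dotr a : 'rV[R]_p -> R) [set x | c < x]);
    last exact: open_gt.
  have cst_cont : continuous (fun _ : 'rV[R]_p => a) by apply: cst_continuous.
  have id_cont : continuous (@id 'rV[R]_p) by move=> M.
  by move=> g _; exact: (continuous_dotr cst_cont id_cont).
apply/seteqP; split=> g /=; rewrite in_itv/= andbT.
  by move=> /ereal_sup_gt[_ [a Da <-]]; rewrite lte_fin => ca; exists a.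
move=> [a Da ca]; apply: (@lt_le_trans _ _ (dotr a g)%:E); first by rewrite lte_fin.
by apply: ereal_sup_ubound; exists a.
Qed.

Section euclidean.
Variables (R : realType) (p : nat).
Implicit Types u v w : 'rV[R]_p.

Lemma dotrC u v : dotr u v = dotr v u.
Proof. by apply: eq_bigr => j _; rewrite mulrC. Qed.

Lemma dotrDl u v w : dotr (u + v) w = dotr u w + dotr v w.
Proof. by rewrite -big_split; apply: eq_bigr => j _; rewrite mxE mulrDl. Qed.

Lemma dotrZl (a : R) u v : dotr (a *: u) v = a * dotr u v.
Proof. by rewrite mulr_sumr; apply: eq_bigr => j _; rewrite mxE mulrA. Qed.

Lemma dotrNl u v : dotr (- u) v = - dotr u v.
Proof. by rewrite -scaleN1r dotrZl mulN1r. Qed.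

Lemma dotrDr u v w : dotr u (v + w) = dotr u v + dotr u w.
Proof. by rewrite dotrC dotrDl !(dotrC u). Qed.

Lemma dotrZr (a : R) u v : dotr u (a *: v) = a * dotr u v.
Proof. by rewrite dotrC dotrZl dotrC. Qed.

Lemma dotrNr u v : dotr u (- v) = - dotr u v.
Proof. by rewrite dotrC dotrNl dotrC. Qed.

Lemma dotr_sub_scale (t : R) u v :
  dotr (u - t *: v) (u - t *: v) = dotr u u - 2 * t * dotr u v + t ^+ 2 * dotr v v.
Proof.
by rewrite dotrDl !dotrDr !dotrNl !dotrNr !dotrZl !dotrZr (dotrC v u); ring.
Qed.

Lemma dotr_ge0 u : 0 <= dotr u u.
Proof. by apply: sumr_ge0 => j _; rewrite -expr2 sqr_ge0. Qed.

Lemma l2norm_sq u : l2norm u ^+ 2 = dotr u u.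
Proof. by rewrite sqr_sqrtr// dotr_ge0. Qed.

Lemma mx_norm_le_l2norm u : `|u| <= l2norm u.
Proof.
rewrite /Num.norm/= mx_normrE; apply: bigmax_le => [|[i j] _]; first exact: sqrtr_ge0.
rewrite ord1/= -sqrtr_sqr ler_wsqrtr// expr2 /dotr (bigD1 j)//= lerDl.
by apply: sumr_ge0 => k _; rewrite -expr2 sqr_ge0.
Qed.

Variable C : set 'rV[R]_p.
Hypothesis closedC : closed C.

Lemma argmin_dist_nonempty (x y : 'rV[R]_p) : C x ->
  argmin C (fun z => 2^-1 * l2norm (y - z) ^+ 2) !=set0.
Proof.
move=> Cx; pose f z := dotr (y - z) (y - z).
have cy : continuous (fun z : 'rV[R]_p => y - z).
  have cst_cont : continuous (fun _ : 'rV[R]_p => y) by apply: cst_continuous.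
  have id_cont : continuous (@id 'rV[R]_p) by move=> M.
  by move=> z; apply: continuousB; [exact: cst_cont|exact: id_cont].
have cf : continuous f by exact: continuous_dotr.
pose K := C `&` f @^-1` [set r | r <= f x].
have Kx : K x by split=> //=.
have clK : closed K.
  apply: closedI => //; apply: closed_comp; last exact: closed_le.
  by move=> z _; exact: cf.
have bK : bounded_set K.
  exists (`|y| + Num.sqrt (f x)); split; first by rewrite num_real.
  move=> M ltM z [_ /= fz]; apply: le_trans (ltW ltM).
  rewrite -[z in leLHS](subKr y) (le_trans (ler_normB _ _))// lerD2l.
  by rewrite (le_trans (mx_norm_le_l2norm _))// ler_wsqrtr.
have [z /set_mem[Cz _] minz] := EVT_min_rV (ex_intro _ x Kx)
  (bounded_closed_compact bK clK)  (continuous_subspaceT cf).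
exists z; split=> // t Ct; rewrite !l2norm_sq ler_pM2l ?invr_gt0//.
have [ft|/ltW ft] := leP (f t) (f x); first by apply: minz; rewrite inE.
by apply: le_trans ft; apply: minz; rewrite inE.
Qed.

Hypothesis convexC : convex_set (C : set (convex_lmodType 'rV[R]_p)).

Lemma xhat_mem (x y : 'rV[R]_p) : C x -> C (xhat C y).
Proof. by move=> /(argmin_dist_nonempty y)/getPex[]. Qed.

Lemma xhat_variational (x y : 'rV[R]_p) : C x ->
  dotr (y - xhat C y) (x - xhat C y) <= 0.
Proof.
move=> Cx; have [Ch minh] := getPex (argmin_dist_nonempty y Cx).
rewrite -/(xhat C y) in Ch minh; set h := xhat C y in Ch minh *.
rewrite leNgt; apply/negP => wd0.
set w := y - h in wd0; set v := x - h in wd0; set a := dotr w v in wd0.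
have b0 := dotr_ge0 v; set b := dotr v v in b0.
have ab0 : 0 < a + b by rewrite ltr_wpDr.
have t0 : 0 <= a / (a + b) by rewrite divr_ge0// ltW.
have t1 : a / (a + b) <= 1 by rewrite ler_pdivrMr// mul1r lerDl.
have := @convexC x h (Itv01 t0 t1) (mem_set Cx) (mem_set Ch).
rewrite inE => /minh; rewrite !l2norm_sq ler_pM2l ?invr_gt0//.
set t := a / (a + b) in t0 t1 *.
have -> : y - (t *: x + (1 - t) *: h) = w - t *: v.
  by rewrite /w /v scalerBl scale1r scalerBr; apply/rowP => j; rewrite !mxE; ring.
rewrite dotr_sub_scale -/a -/b.
have tab : t * (a + b) = a by rewrite divfK// gt_eqF.
nra.
Qed.

Lemma xhat_dist (x y : 'rV[R]_p) : C x ->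
  dotr (xhat C y - x) (xhat C y - x) <= dotr (xhat C y - x) (y - x).
Proof.
move=> /(xhat_variational y); set h := xhat C y.
rewrite (_ : y - h = (y - x) - (h - x)); last by rewrite opprB addrA subrK.
rewrite -(opprB h x) dotrNr dotrDl dotrNl (dotrC (y - x)) opprD opprK.
by rewrite addrC subr_le0.
Qed.

End euclidean.

Lemma ge0_le_integral_nonmeasurable (R : realType) (d : measure_display)
    (T : measurableType d) (mu : {measure set T -> \bar R}) (f g : T -> \bar R) :
  (forall x, 0 <= f x)%E -> (forall x, f x <= g x)%E ->
  (\int[mu]_x f x <= \int[mu]_x g x)%E.
Proof.
move=> f0 fg; have g0 x : (0 <= g x)%E by exact: le_trans (fg x).
rewrite !ge0_integralTE//; apply: le_ereal_sup; apply: image_subset => h /= hf x.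
exact: le_trans (fg x).
Qed.

Section sup_sq.
Variables (R : realType) (p : nat) (D : set 'rV[R]_p).
Hypothesis D0 : D 0.

Let sup g := ereal_sup [set (dotr a g)%:E | a in D].

Lemma sup_dotr_ge0 g : (0 <= sup g)%E.
Proof.
apply: ereal_sup_ubound; exists 0 => //.
by rewrite -[0 in LHS](scale0r 0) dotrZl mul0r.
Qed.

Lemma sup_dotr_sq_ge0 g : (0 <= sup g ^+ 2)%E.
Proof. by rewrite expe2 mule_ge0// sup_dotr_ge0. Qed.

Lemma measurable_sup_dotr_sq : measurable_fun [set: 'rV[R]_p] (fun g => sup g ^+ 2)%E.
Proof.
under eq_fun do rewrite expe2.
by apply: emeasurable_funM; exact: measurable_sup_dotr.
Qed.

Lemma sup_dotr_sq_scale (c : R) g : 0 < c ->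
  (sup (c *: g) ^+ 2 = (c ^+ 2)%:E * sup g ^+ 2)%E.
Proof.
move=> c0; have -> : sup (c *: g) = (c%:E * sup g)%E.
  rewrite /sup -ereal_sup_pZl// image_comp; congr ereal_sup.
  by apply: eq_imagel => a _ /=; rewrite dotrZr EFinM.
by rewrite !expe2 expr2 EFinM muleACA.
Qed.

End sup_sq.

Lemma tangent_cone_ball0 (R : realType) (p : nat) (C : set 'rV[R]_p) (x : 'rV[R]_p) :
  (tangent_cone C x `&` l2ball R p) 0.
Proof.
split; first by exists 0%N, (fun=> 0), (fun=> 0); split=> [[]//|]; rewrite big_ord0.
by rewrite /l2ball/= /l2norm /dotr big1 ?sqrtr0// => j _; rewrite mxE mul0r.
Qed.

Lemma xhat_dist_sup (R : realType) (p : nat) (C : set 'rV[R]_p) (x y : 'rV[R]_p) :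
  closed C -> convex_set (C : set (convex_lmodType 'rV[R]_p)) -> C x ->
  ((l2norm (x - xhat C y) ^+ 2)%:E <=
   ereal_sup [set (dotr a (y - x))%:E | a in tangent_cone C x `&` l2ball R p] ^+ 2)%E.
Proof.
move=> clC cvC Cx; set h := xhat C y.
have Ch : C h by exact: xhat_mem Cx.
have dist := xhat_dist clC cvC y Cx; rewrite -/h in dist.
have D0 := @tangent_cone_ball0 _ _ C x.
have -> : l2norm (x - h) = l2norm (h - x).
  by rewrite /l2norm -(opprB h x) dotrNl dotrNr opprK.
have [N0|N0] := eqVneq (l2norm (h - x)) 0.
  by rewrite N0 expr0n/= sup_dotr_sq_ge0.
have Npos : 0 < l2norm (h - x) by rewrite lt_neqAle eq_sym N0 sqrtr_ge0.
rewrite expr2 EFinM expe2.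
suff le : ((l2norm (h - x))%:E <= ereal_sup [set (dotr a (y - x))%:E |
    a in tangent_cone C x `&` l2ball R p])%E.
  by apply: lee_pmul => //; rewrite lee_fin ltW.
apply: (@le_trans _ _ (dotr ((l2norm (h - x))^-1 *: (h - x)) (y - x))%:E).
  by rewrite lee_fin dotrZl ler_pdivlMl// -expr2 l2norm_sq.
apply: ereal_sup_ubound; exists ((l2norm (h - x))^-1 *: (h - x)) => //; split.
  exists 1%N, (fun=> (l2norm (h - x))^-1), (fun=> h - x); split.
    by move=> _; split; [rewrite invr_ge0 ltW|exists h].
  by rewrite big_ord1.
rewrite /l2ball/= {1}/l2norm dotrZl dotrZr -l2norm_sq mulrA -expr2 -exprMn mulVf//.
by rewrite expr1n sqrtr1.
Qed.

Theorem proposition4 (R : realType) (p : nat)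
    (S : set 'rV[R]_p) (xstar : 'rV[R]_p) (hxstar : S xstar)
    (C : set 'rV[R]_p) (hclosed : closed C)
    (hconvex : convex_set (C : set (convex_lmodType 'rV[R]_p)))
    (hSC : S `<=` C)
    (sigma : R) (hsigma : 0 < sigma) (n : nat) (hn : (1 <= n)%N)
    (d : measure_display) (Omega : measurableType d) (P : probability Omega R)
    (y : 'I_n -> {RV P >-> 'rV[R]_p})
    (hindep : mutually_independent y)
    (hlaw : forall (i : 'I_n) (A : set 'rV[R]_p), measurable A ->
       distribution P (y i) A =
       pushforward (std_gaussian R p)
         (fun z : 'rV[R]_p => xstar + sigma *: z) A) :
  ('E_P[fun w => ((l2norm (xstar - xhat C (sample_mean (fun i => y i w)))) ^+ 2)%R]
   <= (sigma ^+ 2 / n%:R)%R%:E *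
      gaussian_sq_complexity (tangent_cone C xstar `&` l2ball R p))%E.
Proof.
have Cx := hSC _ hxstar.
have n0 : (0 < n%:R :> R) by rewrite ltr0n.
rewrite unlock /gaussian_sq_complexity.
set D := tangent_cone C xstar `&` l2ball R p.
have D0 : D 0 by exact: tangent_cone_ball0.
pose h g := (ereal_sup [set (dotr a g)%:E | a in D] ^+ 2)%E.
have mh : measurable_fun [set: 'rV[R]_p] h by exact: measurable_sup_dotr_sq.
have h0 g : (0 <= h g)%E by exact: sup_dotr_sq_ge0.
pose sum w := \sum_i (y i w - xstar).
have msum : measurable_fun [set: Omega] sum by exact: measurable_centered_sum.
have meanE w : sample_mean (fun i => y i w) - xstar = n%:R^-1 *: sum w.
  rewrite /sum big_split/= sumr_const card_ord scalerDr; congr (_ + _).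
  by rewrite -(scaler_nat n (- xstar)) scalerA mulVf ?gt_eqF// scale1r.
have sumE A : measurable A ->
    P (sum @^-1` A) = std_gaussian R p [set g | A ((Num.sqrt n%:R * sigma) *: g)].
  move=> mA.
  have := partial_sum_law hindep hlaw (B := fun=> setT) (leqnn n) mA (fun=> measurableT).
  rewrite [X in (_ * P X)%E](_ : _ = setT) ?probability_setT ?mule1; last first.
    by apply/seteqP.
  move=> <-; congr (P _); apply/seteqP; split=> w /=.
    by move=> Aw; split=> //; rewrite (eq_bigl xpredT)// => i; rewrite ltn_ord.
  by move=> [+ _]; rewrite (eq_bigl xpredT)// => i; rewrite ltn_ord.
(* [xhat C] is a choice of minimizer, not known to be measurable, so the
   comparison of integrals uses that the integral is a supremum. *)
apply: (@le_trans _ _ (\int[P]_w h (n%:R^-1 *: sum w))%E).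
  apply: ge0_le_integral_nonmeasurable => w /=; first by rewrite lee_fin sqr_ge0.
  by rewrite -meanE; exact: xhat_dist_sup.
have mhn : measurable_fun [set: 'rV[R]_p] (fun v => h (n%:R^-1 *: v)).
  exact: (measurableT_comp mh (measurable_rV_scale _)).
have mscale : measurable_fun [set: 'rV[R]_p]
    (fun g : 'rV[R]_p => (Num.sqrt n%:R * sigma) *: g).
  exact: measurable_rV_scale.
rewrite le_eqVlt; apply/orP; left; apply/eqP.
transitivity (\int[pushforward P sum]_v h (n%:R^-1 *: v)%R)%E.
  by rewrite ge0_integral_pushforward.
transitivity (\int[pushforward (std_gaussian R p)
    (fun g : 'rV[R]_p => (Num.sqrt n%:R * sigma) *: g)%R]_v h (n%:R^-1 *: v)%R)%E.
  by apply: eq_measure_integral => A mA _; exact: sumE.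
rewrite ge0_integral_pushforward//.
transitivity (\int[std_gaussian R p]_g ((sigma ^+ 2 / n%:R)%:E * h g))%E; last first.
  by rewrite ge0_integralZl// lee_fin divr_ge0// ?sqr_ge0// ltW.
apply: eq_integral => g _ /=.
rewrite scalerA /h sup_dotr_sq_scale; last by rewrite !mulr_gt0 ?invr_gt0 ?sqrtr_gt0.
congr (_%:E * _)%E; rewrite !exprMn sqr_sqrtr ?ltW// exprVn expr2 invfM.
by field; rewrite gt_eqF.
Qed.
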